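(* Let $x,x'\in\mathbb{R}$ and let $z,z'$ be in the open upper half plane. Then the limit $\widetilde K=\lim_{M\to\infty}\widetilde K_{2M}$ (pointwise) of the matrix kernels of Ginibre's real ensemble is as follows. (1) Real/real: $$\widetilde K(x,x')=\begin{bmatrix}\frac1{\sqrt{2\pi}}(x'-x)e^{-\frac12(x-x')^2}&\frac1{\sqrt{2\pi}}e^{-\frac12(x-x')^2}\\-\frac1{\sqrt{2\pi}}e^{-\frac12(x-x')^2}&\frac12\operatorname{sgn}(x-x')\operatorname{erfc}\!\left(\frac{|x-x'|}{\sqrt2}\right)\end{bmatrix}.$$ (2) Complex/complex: $$\widetilde K(z,z')=\frac1{\sqrt{2\pi}}\sqrt{\operatorname{erfc}(\sqrt2\operatorname{Im}z)\operatorname{erfc}(\sqrt2\operatorname{Im}z')}\begin{bmatrix}(z'-z)e^{-\frac12(z-z')^2}&i(\overline{z'}-z)e^{-\frac12(z-\overline{z'})^2}\\i(z'-\overline z)e^{-\frac12(\overline z-z')^2}&-(\overline{z'}-\overline z)e^{-\frac12(\overline z-\overline{z'})^2}\end{bmatrix}.$$ (3) Real/complex: $$\widetilde K(x,z)=\frac1{\sqrt{2\pi}}\sqrt{\operatorname{erfc}(\sqrt2\operatorname{Im}z)}\begin{bmatrix}(z-x)e^{-\frac12(x-z)^2}&i(\overline z-x)e^{-\frac12(x-\overline z)^2}\\-e^{-\frac12(x-z)^2}&-i\,e^{-\frac12(x-\overline z)^2}\end{bmatrix}.$$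
   Context: $\operatorname{erfc}(x)=\frac2{\sqrt\pi}\int_x^\infty e^{-t^2}dt$; $\gamma(a,x)=\int_0^xt^{a-1}e^{-t}dt$; $c_M(\gamma)=\sum_{m=0}^{M-1}\frac{\gamma^{2m}}{(2m)!}$; $e_M(\gamma)=\sum_{m=0}^{2M-2}\frac{\gamma^m}{m!}$; $\mathcal{E}(\gamma,\gamma')=\frac12\operatorname{sgn}(\gamma-\gamma')$ for $\gamma,\gamma'\in\mathbb{R}$ and $0$ otherwise; $r_M(z,x)=\frac{2^{M-3/2}}{(2M-2)!}\operatorname{sgn}(x)z^{2M-1}\gamma(M-\frac12,\frac{x^2}2)$. The matrix kernel of Ginibre's real ensemble of $2M\times2M$ matrices is $$\widetilde K_{2M}(\gamma,\gamma')=\begin{bmatrix}\widetilde{DS}_{2M}(\gamma,\gamma')&\widetilde S_{2M}(\gamma,\gamma')\\-\widetilde S_{2M}(\gamma',\gamma)&\widetilde{IS}_{2M}(\gamma,\gamma')+\mathcal{E}(\gamma,\gamma')\end{bmatrix},$$ with, for $x,x'\in\mathbb{R}$, $z,z'$ in the open upper half plane, $E(z)=\sqrt{\operatorname{erfc}(\sqrt2\operatorname{Im}z)}$: Real/real: $\widetilde S_{2M}(x,x')=\frac{e^{-\frac12(x-x')^2}}{\sqrt{2\pi}}e^{-xx'}e_M(xx')+\frac{e^{-x^2/2}}{\sqrt{2\pi}}r_M(x,x')$; $\widetilde{DS}_{2M}(x,x')=\frac{e^{-\frac12(x-x')^2}}{\sqrt{2\pi}}(x'-x)e^{-xx'}e_M(xx')$;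 $\widetilde{IS}_{2M}(x,x')=\frac{e^{-x^2/2}}{2\sqrt\pi}\operatorname{sgn}(x')\int_0^{x'^2/2}\frac{e^{-t}}{\sqrt t}c_M(x\sqrt{2t})dt-\frac{e^{-x'^2/2}}{2\sqrt\pi}\operatorname{sgn}(x)\int_0^{x^2/2}\frac{e^{-t}}{\sqrt t}c_M(x'\sqrt{2t})dt$. Complex/complex: $\widetilde S_{2M}(z,z')=\frac{i e^{-\frac12(z-\overline{z'})^2}}{\sqrt{2\pi}}(\overline{z'}-z)E(z)E(z')e^{-z\overline{z'}}e_M(z\overline{z'})$; $\widetilde{DS}_{2M}(z,z')=\frac{e^{-\frac12(z-z')^2}}{\sqrt{2\pi}}(z'-z)E(z)E(z')e^{-zz'}e_M(zz')$; $\widetilde{IS}_{2M}(z,z')=-\frac{e^{-\frac12(\overline z-\overline{z'})^2}}{\sqrt{2\pi}}(\overline{z'}-\overline z)E(z)E(z')e^{-\overline z\,\overline{z'}}e_M(\overline z\,\overline{z'})$. Real/complex: $\widetilde S_{2M}(x,z)=\frac{i e^{-\frac12(x-\overline z)^2}}{\sqrt{2\pi}}(\overline z-x)E(z)e^{-x\overline z}e_M(x\overline z)$; $\widetilde S_{2M}(z,x)=\frac{e^{-\frac12(x-z)^2}}{\sqrt{2\pi}}E(z)e^{-xz}e_M(xz)+\frac{e^{-z^2/2}}{\sqrt{2\pi}}E(z)r_M(z,x)$; $\widetilde{DS}_{2M}(x,z)=\frac{e^{-\frac12(x-z)^2}}{\sqrt{2\pi}}(z-x)E(z)e^{-xz}e_M(xz)$;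 $\widetilde{IS}_{2M}(x,z)=-i\big\{\frac{e^{-\frac12(x-\overline z)^2}}{\sqrt{2\pi}}E(z)e^{-x\overline z}e_M(x\overline z)+\frac{e^{-\overline z^2/2}}{\sqrt{2\pi}}E(z)r_M(\overline z,x)\big\}$. *)

(* Defs.v *)
From HB Require Import structures.
From mathcomp Require Import all_boot all_order all_algebra.
From mathcomp Require Import all_classical all_reals all_analysis.
From mathcomp Require Import complex.

Set Implicit Arguments.
Unset Strict Implicit.
Unset Printing Implicit Defensive.

Import Order.TTheory GRing.Theory Num.Theory.
Import numFieldNormedType.Exports.

Local Open Scope classical_set_scope.
Local Open Scope ring_scope.
Local Open Scope complex_scope.

Definition cexp {R : realType} (z : R[i]) : R[i] :=
  (expR (complex.Re z))%:C
    * (cos (complex.Im z) +i* sin (complex.Im z)).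

Definition erfc {R : realType} (x : R) : R :=
  2 / Num.sqrt pi * \int[lebesgue_measure]_(t in `[x, +oo[) expR (- t ^+ 2).

(* When [a < 1], the integrand takes the conventional value [0] at [t = 0]
   (since [0 `^ b = 0] for [b != 0]); this does not affect the integral. *)
Definition lower_gamma {R : realType} (a x : R) : R :=
  \int[lebesgue_measure]_(t in `[0, x]) (t `^ (a - 1) * expR (- t)).

(* Natural-number subtractions below are truncated only when [M = 0], which is
   irrelevant to the limit as [M] tends to infinity. *)

Definition c_ {F : fieldType} (M : nat) (g : F) : F :=
  \sum_(m < M) g ^+ (2 * m) / (2 * m)`!%:R.

(* [m] ranges over [0, ..., 2M - 2]. *)
Definition e_ {F : fieldType} (M : nat) (g : F) : F :=
  \sum_(m < (2 * M).-1) g ^+ m / m`!%:R.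

Definition r_ {R : realType} (M : nat) (z : R[i]) (x : R) : R[i] :=
  (2 `^ (M%:R - 3 / 2) / (2 * M - 2)`!%:R * Num.sg x)%:C
    * z ^+ (2 * M - 1)
    * (lower_gamma (M%:R - 1 / 2) (x ^+ 2 / 2))%:C.

(* A point of the union of the real line and the open upper half plane; a point
   [Cpt z] is only meaningful when [0 < Im z]. *)
Inductive point (R : realType) := Rpt of R | Cpt of R[i].

Arguments Rpt {R}.
Arguments Cpt {R}.

Definition curlyE {R : realType} (g g' : point R) : R[i] :=
  match g, g' with
  | Rpt x, Rpt x' => (2^-1 * Num.sg (x - x'))%:C
  | _, _ => 0
  end.

Definition E_ {R : realType} (z : R[i]) : R[i] :=
  (Num.sqrt (erfc (Num.sqrt 2 * complex.Im z)))%:C.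

Definition sqrt2pi {R : realType} : R[i] := (Num.sqrt (2 * pi : R))%:C.

Definition S_ {R : realType} (M : nat) (g g' : point R) : R[i] :=
  match g, g' with
  | Rpt x, Rpt x' =>
      cexp (- 2^-1 * (x%:C - x'%:C) ^+ 2) / sqrt2pi
        * cexp (- (x%:C * x'%:C)) * e_ M (x%:C * x'%:C)
      + cexp (- (x%:C ^+ 2 / 2)) / sqrt2pi * r_ M x%:C x'
  | Cpt z, Cpt z' =>
      'i%C * cexp (- 2^-1 * (z - conjc z') ^+ 2) / sqrt2pi * (conjc z' - z)
        * E_ z * E_ z' * cexp (- (z * conjc z')) * e_ M (z * conjc z')
  | Rpt x, Cpt z =>
      'i%C * cexp (- 2^-1 * (x%:C - conjc z) ^+ 2) / sqrt2pi * (conjc z - x%:C)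
        * E_ z * cexp (- (x%:C * conjc z)) * e_ M (x%:C * conjc z)
  | Cpt z, Rpt x =>
      cexp (- 2^-1 * (x%:C - z) ^+ 2) / sqrt2pi
        * E_ z * cexp (- (x%:C * z)) * e_ M (x%:C * z)
      + cexp (- (z ^+ 2 / 2)) / sqrt2pi * E_ z * r_ M z x
  end.

(* The (real, complex) value of [DS_], and its opposite for (complex, real),
   [DS_] being skew-symmetric. *)
Definition DS_rc {R : realType} (M : nat) (x : R) (z : R[i]) : R[i] :=
  cexp (- 2^-1 * (x%:C - z) ^+ 2) / sqrt2pi * (z - x%:C)
    * E_ z * cexp (- (x%:C * z)) * e_ M (x%:C * z).

Definition DS_ {R : realType} (M : nat) (g g' : point R) : R[i] :=
  match g, g' with
  | Rpt x, Rpt x' =>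
      cexp (- 2^-1 * (x%:C - x'%:C) ^+ 2) / sqrt2pi * (x'%:C - x%:C)
        * cexp (- (x%:C * x'%:C)) * e_ M (x%:C * x'%:C)
  | Cpt z, Cpt z' =>
      cexp (- 2^-1 * (z - z') ^+ 2) / sqrt2pi * (z' - z)
        * E_ z * E_ z' * cexp (- (z * z')) * e_ M (z * z')
  | Rpt x, Cpt z => DS_rc M x z
  | Cpt z, Rpt x => - DS_rc M x z
  end.

(* One of the two terms of the real/real [IS_]; the other one is obtained by
   exchanging the variables. *)
Definition IS_term {R : realType} (M : nat) (x x' : R) : R :=
  expR (- (x ^+ 2 / 2)) / (2 * Num.sqrt pi) * Num.sg x'
    * \int[lebesgue_measure]_(t in `[0, x' ^+ 2 / 2])
        (expR (- t) / Num.sqrt t * c_ M (x * Num.sqrt (2 * t))).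

(* As for [DS_], the (complex, real) value of [IS_] is given by skew-symmetry. *)
Definition IS_rc {R : realType} (M : nat) (x : R) (z : R[i]) : R[i] :=
  - 'i%C * (cexp (- 2^-1 * (x%:C - conjc z) ^+ 2) / sqrt2pi
            * E_ z * cexp (- (x%:C * conjc z)) * e_ M (x%:C * conjc z)
          + cexp (- (conjc z ^+ 2 / 2)) / sqrt2pi * E_ z * r_ M (conjc z) x).

Definition IS_ {R : realType} (M : nat) (g g' : point R) : R[i] :=
  match g, g' with
  | Rpt x, Rpt x' => (IS_term M x x' - IS_term M x' x)%:C
  | Cpt z, Cpt z' =>
      - (cexp (- 2^-1 * (conjc z - conjc z') ^+ 2) / sqrt2pi * (conjc z' - conjc z)
           * E_ z * E_ z' * cexp (- (conjc z * conjc z'))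
        * e_ M (conjc z * conjc z'))
  | Rpt x, Cpt z => IS_rc M x z
  | Cpt z, Rpt x => - IS_rc M x z
  end.

Definition mx22 {T : Type} (a b c d : T) : 'M[T]_2 :=
  \matrix_(i, j) if i == ord0 then (if j == ord0 then a else b)
                 else (if j == ord0 then c else d).

(* [ginibreK M] is the matrix kernel for [2M x 2M] matrices. [R[i]^o] equips the
   complex numbers with the topology of their norm, and ['M[R[i]^o]_2] carries
   the corresponding entrywise topology. *)
Definition ginibreK {R : realType} (M : nat) (g g' : point R) : 'M[R[i]^o]_2 :=
  mx22 (DS_ M g g') (S_ M g g')
       (- S_ M g' g) (IS_ M g g' + curlyE g g').

(* Main.v *)
(* Every entry except the real/real [IS_] is, up to a constant factor,
   [c * cexp (- w) * e_ M w] plus possibly a multiple of [r_ M]; here [e_ M w] tends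
   to [cexp w], and [r_ M z x] tends to [0], being bounded by
   [|x z| ^ (2M - 1) / (2M - 2)!].

   For the real/real [IS_], monotone convergence replaces [c_ M] by [cosh]. With
   [y = x / sqrt 2], [y' = x' / sqrt 2] and [s = sqrt t], completing the square gives
   [exp (- y ^ 2 - s ^ 2) cosh (2 y s) = (exp (- (s - y) ^ 2) + exp (- (s + y) ^ 2)) / 2],
   so that the limit of [IS_term] is [(2 - erfc (y' - y) - erfc (y' + y)) / 4]; the
   terms in [y' + y] cancel by antisymmetry. *)

Require Import Defs.
From mathcomp Require Import all_boot all_order all_algebra.
From mathcomp Require Import all_classical all_reals all_analysis.
From mathcomp Require Import complex measurable_realfun gauss_integral ring lra zify.

Set Implicit Arguments.
Unset Strict Implicit.
Unset Printing Implicit Defensive.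

Import Order.TTheory GRing.Theory Num.Theory.
Import numFieldNormedType.Exports.

Local Open Scope classical_set_scope.
Local Open Scope ring_scope.
Local Open Scope complex_scope.

(** * Convergence of matrices and of complex sequences *)

Lemma cvg_mx22 (T : topologicalType) (u1 u2 u3 u4 : nat -> T) (a b c d : T) :
  u1 n @[n --> \oo] --> a -> u2 n @[n --> \oo] --> b ->
  u3 n @[n --> \oo] --> c -> u4 n @[n --> \oo] --> d ->
  mx22 (u1 n) (u2 n) (u3 n) (u4 n) @[n --> \oo] --> (mx22 a b c d : 'M[T]_2).
Proof.
move=> cu1 cu2 cu3 cu4 A [P nP PA].
have := nP 0 0; have := nP 0 1; have := nP 1 0; have := nP 1 1.
rewrite !mxE /= => /cu4 h4 /cu3 h3 /cu2 h2 /cu1 h1.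
suff : \forall n \near \oo, A (mx22 (u1 n) (u2 n) (u3 n) (u4 n)) by [].
near=> n; apply: PA => i j.
case: i => [[|[|//]] hi]; case: j => [[|[|//]] hj]; rewrite mxE /=.
- rewrite (_ : Ordinal hi = 0) 1?(_ : Ordinal hj = 0); [|exact/val_inj..].
  by near: n.
- rewrite (_ : Ordinal hi = 0) 1?(_ : Ordinal hj = 1); [|exact/val_inj..].
  by near: n.
- rewrite (_ : Ordinal hi = 1) 1?(_ : Ordinal hj = 0); [|exact/val_inj..].
  by near: n.
- rewrite (_ : Ordinal hi = 1) 1?(_ : Ordinal hj = 1); [|exact/val_inj..].
  by near: n.
Unshelve. all: by end_near. Qed.

Lemma cvg_complex_squeeze (R : realType) (r : nat -> R) (u : nat -> R[i]) l :
  (\forall n \near \oo, `|u n - l| <= (r n)%:C) -> r n @[n --> \oo] --> 0 ->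
  u n @[n --> \oo] --> (l : R[i]^o).
Proof.
move=> ur r0; apply/(@cvgrPdist_lt _ R[i]^o) => /= -[e f].
(* A positive element of [R[i]] has zero imaginary part, so the radius of the neighbourhood is a
   real number and can be compared with [r n]. *)
rewrite ltcE /= => /andP[/eqP -> e0].
near=> n; rewrite distrC; apply: (@le_lt_trans _ _ (r n)%:C); first by near: n.
rewrite ltcR; apply: le_lt_trans (ler_norm _) _.
by near: n; move/cvgr0Pnorm_lt : r0; exact.
Unshelve. all: by end_near. Qed.

Lemma cvg_complex (R : realType) (a b : nat -> R) (x y : R) :
  a n @[n --> \oo] --> x -> b n @[n --> \oo] --> y ->
  (a n +i* b n) @[n --> \oo] --> (x +i* y : R[i]^o).
Proof.
move=> ax bY.
apply: (@cvg_complex_squeeze _ (fun n => `|a n - x| + `|b n - y|)).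
  near=> n.
  have -> : (a n +i* b n) - (x +i* y) = (a n - x)%:C + 'i%C * (b n - y)%:C.
    by apply/eqP; rewrite eq_complex /=; apply/andP; split; apply/eqP; ring.
  apply: le_trans (ler_normD _ _) _.
  rewrite normrM !normc_def /= !expr0n /= !addr0 !add0r expr1n sqrtr1 !sqrtr_sqr.
  by rewrite mul1r rmorphD.
have dist0 (c : nat -> R) (l : R) :
    c n @[n --> \oo] --> l -> `|c n - l| @[n --> \oo] --> 0.
  move=> cl; rewrite -(normr0 R) -(subrr l); apply: cvg_norm.
  by apply: cvgB => //; exact: cvg_cst.
by rewrite -[X in _ --> X]addr0; apply: cvgD; exact: dist0.
Unshelve. all: by end_near. Qed.

Lemma cvg_realC (R : realType) (a : nat -> R) (x : R) :
  a n @[n --> \oo] --> x -> (a n)%:C @[n --> \oo] --> (x%:C : R[i]^o).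
Proof. by move=> ax; apply: cvg_complex => //; exact: cvg_cst. Qed.

(** * Partial sums of the exponential series *)

(** The length [N] is free, so that [e_] is a subsequence and [c_] is built from two of them; the
    field is abstract to allow both [R] and [R[i]]. *)
Definition exp_sum {F : fieldType} (N : nat) (z : F) : F :=
  \sum_(m < N) z ^+ m / m`!%:R.

Lemma exp_sumM (F : numFieldType) (N : nat) (a b : F) :
  exp_sum N a * exp_sum N b = \sum_(i < N) \sum_(j < N)
     (a ^+ i / i`!%:R) * (b ^+ j / j`!%:R).
Proof. by rewrite mulr_suml; apply: eq_bigr => i _; rewrite mulr_sumr. Qed.

(** By the binomial theorem the term of degree [k] is the sum of [a ^ i b ^ j / (i! j!)] over
    [i + j = k]. The truncation [k < N] thus keeps a triangle of the square of indices found in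
    [exp_sumM]. *)
Lemma exp_sumD (F : numFieldType) (N : nat) (a b : F) :
  exp_sum N (a + b) = \sum_(i < N) \sum_(j < N | (i + j < N)%N)
     (a ^+ i / i`!%:R) * (b ^+ j / j`!%:R).
Proof.
have fact_neq0 n : (n`!%:R : F) != 0 by rewrite pnatr_eq0 -lt0n fact_gt0.
pose f i j := (a ^+ i / i`!%:R) * (b ^+ j / j`!%:R).
transitivity (\sum_(0 <= k < N) \sum_(0 <= i < N | (i <= k)%N) f i (k - i)%N).
  rewrite big_mkord; apply: eq_bigr => k _.
  rewrite addrC exprDn mulr_suml.
  rewrite -(big_mkord xpredT
    (fun i => b ^+ (k - i) * a ^+ i *+ 'C(k, i) / k`!%:R)).
  rewrite (big_nat_widen _ _ N) //=.
  apply: eq_bigr => i; rewrite ltnS => ik.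
  rewrite /f -(bin_fact ik) !natrM -mulr_natl; field.
  by rewrite !fact_neq0 /= pnatr_eq0 -lt0n bin_gt0.
(* The sums over [i <= k < N] are exchanged, then [k] is replaced by [j = k - i]. *)
rewrite (exchange_big_dep_nat predT) //= big_mkord; apply: eq_bigr => i _.
transitivity (\sum_(i <= k < N) f i (k - i)%N).
  by rewrite (big_nat_widenl _ 0 N xpredT) //=; apply: eq_bigl => k; rewrite add0n.
rewrite -{1}[nat_of_ord i]add0n big_addn.
rewrite (big_nat_widen _ _ N) ?leq_subr //= big_mkord.
by apply: eq_big => [j|j _]; rewrite ?addnK // ltn_subRL.
Qed.

(* Both sides are sums of [a ^ i b ^ j / (i! j!)] over [i, j < N <= i + j]; since [expR]
   is a morphism the right-hand side tends to [0]. *)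
Lemma norm_exp_sumD (F : numFieldType) (N : nat) (a b : F) :
  `|exp_sum N a * exp_sum N b - exp_sum N (a + b)| <=
  exp_sum N `|a| * exp_sum N `|b| - exp_sum N (`|a| + `|b|).
Proof.
rewrite !exp_sumM !exp_sumD -!sumrB.
apply: le_trans (ler_norm_sum _ _ _) _; apply: ler_sum => i _.
have tail (f : 'I_N -> F) : \sum_j f j - \sum_(j < N | (i + j < N)%N) f j =
    \sum_(j < N | ~~ (i + j < N)%N) f j.
  by apply/eqP; rewrite subr_eq addrC (bigID (fun j : 'I_N => i + j < N)%N).
rewrite !tail.
apply: le_trans (ler_norm_sum _ _ _) _; apply: ler_sum => j _.
by rewrite !normrM !normfV !normrX !normr_nat.
Qed.

Lemma cvg_exp_sumR (R : realType) (x : R) :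
  exp_sum N x @[N --> \oo] --> expR x.
Proof.
have := is_cvg_series_exp_coeff x; rewrite /expR.
rewrite (_ : series (exp_coeff x) = exp_sum ^~ x) //.
by apply/funext => N; rewrite /series /= /exp_sum big_mkord.
Qed.

Lemma exp_sum_real (R : realType) (N : nat) (x : R) :
  exp_sum N x%:C = (exp_sum N x)%:C.
Proof.
rewrite /exp_sum rmorph_sum; apply: eq_bigr => m _.
by rewrite rmorphM fmorphV rmorphXn rmorph_nat.
Qed.

Lemma exp_sum_imag (R : realType) (N : nat) (y : R) :
  exp_sum N (0 +i* y) = series (cos_coeff y) N +i* series (sin_coeff y) N.
Proof.
elim: N => [|N ih].
  by rewrite /exp_sum /series /= big_ord0 !big_geq.
rewrite /exp_sum big_ord_recr /= -/(exp_sum N _) ih /series /= !big_nat_recr //=.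
(* The power of [i] is real for even [N] and imaginary for odd [N]. The two components are written
   exactly as the terms of [cos_coeff] and [sin_coeff]. *)
have -> : (0 +i* y) ^+ N / N`!%:R =
   ((~~ odd N)%:R * (-1) ^ N./2 * y ^+ N / N`!%:R) +i*
   ((odd N)%:R * (-1) ^+ N.-1./2 * y ^+ N / N`!%:R).
  rewrite -[N`!%:R](rmorph_nat (real_complex R)) -fmorphV.
  have -> : (0 +i* y) = 'i * y%:C :> R[i].
    by apply/eqP; rewrite eq_complex /=; apply/andP; split; apply/eqP; ring.
  rewrite exprMn -rmorphXn.
  rewrite -{1}[N]odd_double_half exprD -muln2 mulnC exprM sqr_i.
  rewrite -(rmorphN1 (real_complex R)) -rmorphXn -!exprnP.
  case: (odd N) (odd_double_half N) => /= <-.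
    rewrite add1n /= doubleK uphalf_double.
    by apply/eqP; rewrite eq_complex /=; apply/andP; split; apply/eqP; ring.
  rewrite add0n /= doubleK.
  by apply/eqP; rewrite eq_complex /=; apply/andP; split; apply/eqP; ring.
by [].
Qed.

(* Stated over an abstract field because direct unification at [R[i]] of the
   analytic and algebraic structures takes minutes. *)
Lemma cvg_regularD (K : numFieldType) (u v : nat -> K) (a b : K) :
  u n @[n --> \oo] --> (a : K^o) -> v n @[n --> \oo] --> (b : K^o) ->
  u n + v n @[n --> \oo] --> (a + b : K^o).
Proof. by move=> ua vb; apply: (@cvgD K K^o). Qed.

Lemma cvg_regularN (K : numFieldType) (u : nat -> K) (a : K) :
  u n @[n --> \oo] --> (a : K^o) -> - u n @[n --> \oo] --> (- a : K^o).
Proof. by move=> ua; apply: (@cvgN K K^o). Qed.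

Lemma cvg_regularM (K : numFieldType) (u v : nat -> K) (a b : K) :
  u n @[n --> \oo] --> (a : K^o) -> v n @[n --> \oo] --> (b : K^o) ->
  u n * v n @[n --> \oo] --> (a * b : K^o).
Proof. by move=> ua vb; apply: (@cvgM K). Qed.

Lemma cvg_regularMl (K : numFieldType) (c : K) (u : nat -> K) (a : K) :
  u n @[n --> \oo] --> (a : K^o) -> c * u n @[n --> \oo] --> (c * a : K^o).
Proof. by move=> ua; apply: cvg_regularM; [exact: cvg_cst|exact: ua]. Qed.

(** * Rules for limits in the complex numbers *)

Section complex_limits.
Context {R : realType}.
Implicit Types (u v : nat -> R[i]) (a b : R[i]).

Lemma cvg_complexD u v a b :
  u n @[n --> \oo] --> (a : R[i]^o) -> v n @[n --> \oo] --> (b : R[i]^o) ->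
  u n + v n @[n --> \oo] --> (a + b : R[i]^o).
Proof. exact: (@cvg_regularD R[i]). Qed.

Lemma cvg_complexN u a : u n @[n --> \oo] --> (a : R[i]^o) ->
  - u n @[n --> \oo] --> (- a : R[i]^o).
Proof. exact: (@cvg_regularN R[i]). Qed.

Lemma cvg_complexM u v a b :
  u n @[n --> \oo] --> (a : R[i]^o) -> v n @[n --> \oo] --> (b : R[i]^o) ->
  u n * v n @[n --> \oo] --> (a * b : R[i]^o).
Proof. exact: (@cvg_regularM R[i]). Qed.

Lemma cvg_complexMl c u a : u n @[n --> \oo] --> (a : R[i]^o) ->
  c * u n @[n --> \oo] --> (c * a : R[i]^o).
Proof. exact: (@cvg_regularMl R[i]). Qed.

Lemma cvg_complex_eq (u : nat -> R[i]) (a b : R[i]) :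
  u n @[n --> \oo] --> (a : R[i]^o) -> a = b -> u n @[n --> \oo] --> (b : R[i]^o).
Proof. by move=> ua <-. Qed.

End complex_limits.

(** * The complex exponential as the limit of its partial sums *)

(** Since [cexp] is defined by [expR], [cos] and [sin], the argument is split as [a + i b]. The
    product of the partial sums at [a] and at [i b] converges by the real series, and it differs
    from the partial sum at [a + i b] by a quantity that tends to 0 by [norm_exp_sumD]. *)
Lemma cvg_exp_sum (R : realType) (z : R[i]) :
  exp_sum N z @[N --> \oo] --> (cexp z : R[i]^o).
Proof.
case: z => a b; have -> : a +i* b = a%:C + (0 +i* b).
  by apply/eqP; rewrite eq_complex /=; apply/andP; split; apply/eqP; ring.
set y := 0 +i* b.
have -> : cexp (a%:C + y) = (expR a)%:C * (cos b +i* sin b).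
  by rewrite /cexp /= addr0 add0r.
have cP : exp_sum N a%:C * exp_sum N y @[N --> \oo] -->
    ((expR a)%:C * (cos b +i* sin b) : R[i]^o).
  under eq_fun do rewrite exp_sum_real exp_sum_imag.
  apply: cvg_complexM; first exact/cvg_realC/cvg_exp_sumR.
  apply: cvg_complex; rewrite unlock.
    exact: is_cvg_series_cos_coeff.
  exact: is_cvg_series_sin_coeff.
have cD : exp_sum N a%:C * exp_sum N y - exp_sum N (a%:C + y) @[N --> \oo] -->
    (0 : R[i]^o).
  apply: (@cvg_complex_squeeze _ (fun N =>
    exp_sum N `|a| * exp_sum N `|b| - exp_sum N (`|a| + `|b|))).
    near=> N; rewrite subr0 (rmorphB (real_complex R)) rmorphM /=.
    rewrite -!exp_sum_real rmorphD /=.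
    have := @norm_exp_sumD R[i] N a%:C y.
    by rewrite !normc_def /= !expr0n /= addr0 add0r !sqrtr_sqr.
  rewrite -[X in _ --> X](subrr (expR `|a| * expR `|b|)) -{2}expRD.
  apply: cvgB; first by apply: cvgM; exact: cvg_exp_sumR.
  exact: cvg_exp_sumR.
rewrite (_ : (fun N => exp_sum N (a%:C + y)) = (fun N =>
    exp_sum N a%:C * exp_sum N y -
    (exp_sum N a%:C * exp_sum N y - exp_sum N (a%:C + y)))); last first.
  by apply/funext => N; rewrite subKr.
by have := cvg_complexD cP (cvg_complexN cD); rewrite oppr0 addr0.
Unshelve. all: by end_near. Qed.

Lemma cvg_e_ (R : realType) (z : R[i]) :
  e_ M z @[M --> \oo] --> (cexp z : R[i]^o).
Proof.
apply: (cvg_comp (fun M => (2 * M).-1) (fun N => exp_sum N z)); last first.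
  exact: cvg_exp_sum.
apply/cvgnyPge => A; near=> M.
have : (A.+1 <= M)%N by near: M; exact: nbhs_infty_ge.
lia.
Unshelve. all: by end_near. Qed.

Lemma cexpD (R : realType) (u v : R[i]) : cexp (u + v) = cexp u * cexp v.
Proof.
case: u v => [a b] [c d]; rewrite /cexp /= expRD cosD sinD.
by apply/eqP; rewrite eq_complex /=; apply/andP; split; apply/eqP; ring.
Qed.

Lemma cexpNK (R : realType) (w : R[i]) : cexp (- w) * cexp w = 1.
Proof. by rewrite -cexpD addNr /cexp /= expR0 cos0 sin0 mul1r. Qed.

Lemma cexp_real (R : realType) (x : R) : cexp x%:C = (expR x)%:C.
Proof. by rewrite /cexp /= cos0 sin0 mulr1. Qed.

Lemma cvg_e_cexpN (R : realType) (c w : R[i]) :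
  c * cexp (- w) * e_ M w @[M --> \oo] --> (c : R[i]^o).
Proof.
rewrite -[X in _ --> X]mulr1 -(cexpNK w) mulrA.
exact/cvg_complexMl/cvg_e_.
Qed.

(** * Vanishing of [r_] in the limit *)

(** As [1 <= a], the power [t ^ (a - 1)] is nondecreasing, so the integrand is at most [x ^ (a - 1)]
    on an interval of length [x]. *)
Lemma lower_gamma_le (R : realType) (a x : R) : 1 <= a -> 0 <= x ->
  0 <= lower_gamma a x <= x `^ a.
Proof.
move=> a1 x0; apply/andP; split.
  by apply: Rintegral_ge0 => t _; rewrite mulr_ge0 ?powR_ge0 ?expR_ge0.
have mf : measurable_fun `[0, x]%classic
    (fun t : R => t `^ (a - 1) * expR (- t)).
  apply: measurable_funM.
    by apply: measurable_funTS; exact: measurable_powR.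
  by apply: measurable_funTS; exact: measurableT_comp.
have bd (t : R) : t \in `[0, x] ->
    0 <= t `^ (a - 1) * expR (- t) <= x `^ (a - 1).
  rewrite in_itv /= => /andP[t0 tx].
  rewrite mulr_ge0 ?powR_ge0 ?expR_ge0 //=.
  rewrite -[leRHS]mulr1 ler_pM ?powR_ge0 ?expR_ge0 //.
    by rewrite ge0_ler_powR // ?nnegrE // subr_ge0.
  by rewrite expR_le1 oppr_le0.
have intc : lebesgue_measure.-integrable `[0, x]%classic
    (EFin \o cst (x `^ (a - 1)) : R -> \bar R).
  apply: continuous_compact_integrable; first exact: segment_compact.
  by move=> ?; exact: cst_continuous.
have fin : fine (lebesgue_measure `[0, x]%classic) = x.
  rewrite lebesgue_measure_itv /= lte_fin; case: ltP => /= [_|].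
    by rewrite subr0.
  by move=> ?; apply/le_anti/andP.
apply: (@le_trans _ _
  (\int[lebesgue_measure]_(t in `[0, x]) cst (x `^ (a - 1)) t)).
  apply: le_Rintegral => //.
  - apply: le_integrable intc => //; first exact/measurable_EFinP.
    move=> t /= tx; have /andP[h1 h2] := bd t tx.
    by rewrite lee_fin !ger0_norm ?powR_ge0.
  - by move=> t tx; have /andP[] := bd t tx.
rewrite Rintegral_cst //= fin -[X in _ * X](powRr1 x0) -powRD ?subrK //.
by rewrite gt_eqF // ?subrK (lt_le_trans ltr01 a1).
Qed.

(** The bound on [lower_gamma] turns the power of 2 and the gamma factor into at most
    [|x| ^ (2M - 1)]. With [w = |x| |z|] this bounds [r_] by [w] times the exponential coefficient
    of [w] of index [2M - 2], which tends to 0. *)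
Lemma cvg_r_ (R : realType) (z : R[i]) (x : R) :
  r_ M z x @[M --> \oo] --> (0 : R[i]^o).
Proof.
case: z => p q; pose nz := Num.sqrt (p ^+ 2 + q ^+ 2); pose w := `|x| * nz.
have nz0 : 0 <= nz by exact: sqrtr_ge0.
apply: (@cvg_complex_squeeze _
  (fun M => w * exp_coeff w (2 * M - 2)%N)); last first.
  rewrite -(mulr0 w); apply: cvgMr.
  apply: (cvg_comp (fun M => 2 * M - 2)%N (exp_coeff w)); last first.
    exact: cvg_exp_coeff.
  apply/cvgnyPge => A; near=> M.
  have : (A.+1 <= M)%N by near: M; exact: nbhs_infty_ge.
  lia.
(* This makes the exponent [M - 1/2] at least 1, as [lower_gamma_le] requires. *)
near=> M; have M2 : (2 <= M)%N by near: M; exact: nbhs_infty_ge.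
have M2R : 2 <= M%:R :> R by rewrite (ler_nat R 2).
rewrite subr0 /r_ !normrM normrX !normc_def /= !expr0n /= !addr0 !sqrtr_sqr -/nz.
rewrite -rmorphXn /= -!rmorphM /= lecR /exp_coeff /=.
have a1 : 1 <= M%:R - 1 / 2 :> R by lra.
have x20 : 0 <= x ^+ 2 / 2 by rewrite divr_ge0 ?sqr_ge0.
have /andP[g0 gle] := lower_gamma_le a1 x20.
rewrite (ger0_norm g0).
have sgle : `|Num.sg x| <= 1 by rewrite normr_sg; case: (x != 0).
have powx : 2 `^ (M%:R - 3 / 2) * (x ^+ 2 / 2) `^ (M%:R - 1 / 2) <=
    `|x| ^+ (2 * M - 1) :> R.
  apply: (@le_trans _ _
    (2 `^ (M%:R - 1 / 2) * (x ^+ 2 / 2) `^ (M%:R - 1 / 2))).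
    (* Raising the exponent of 2 from [M - 3/2] to [M - 1/2] lets it cancel the denominator of
       [x ^ 2 / 2]. *)
    by apply: ler_wpM2r; rewrite ?powR_ge0 // ler_powR ?ler1n //; lra.
  rewrite -powRM // mulrCA divff ?pnatr_eq0 // mulr1.
  rewrite -[x ^+ 2]real_normK ?num_real // -powR_mulrn // -powRrM -powR_mulrn //.
  rewrite (_ : 2%:R * (M%:R - 1 / 2) = (2 * M - 1)%N%:R) //.
  by rewrite natrB ?natrM; [field|lia].
have f0 : 0 < (2 * M - 2)`!%:R :> R by rewrite ltr0n fact_gt0.
have -> : w * (w ^+ (2 * M - 2) / (2 * M - 2)`!%:R) =
    `|x| ^+ (2 * M - 1) * nz ^+ (2 * M - 1) / (2 * M - 2)`!%:R.
  by rewrite mulrA -exprS -exprMn; congr (_ ^+ _ / _); lia.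
rewrite 2!normrM (ger0_norm (powR_ge0 _ _)) [`|_^-1|]ger0_norm ?invr_ge0 //.
set B := nz ^+ _; have B0 : 0 <= B by rewrite exprn_ge0.
rewrite ler_pdivlMr //.
have -> : forall p s g f : R, f != 0 ->
    p / f * s * B * g * f = s * (p * g) * B.
  by move=> ? ? ? ? ?; field.
  apply: ler_wpM2r => //; apply: le_trans powx.
  rewrite -[leRHS]mul1r ler_pM //.
    by rewrite mulr_ge0 ?powR_ge0.
  by rewrite ler_wpM2l ?powR_ge0.
by rewrite gt_eqF.
Unshelve. all: by end_near. Qed.

(** * The complementary error function *)

Section erfc.
Context {R : realType}.
Notation mu := (@lebesgue_measure R).
Implicit Types y : R.

Let gauss_cdf y : R := \int[mu]_(t in `]-oo, y]) gauss_fun t.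

Let integrable_gauss (A : set R) : measurable A ->
  mu.-integrable A (EFin \o gauss_fun).
Proof. by move=> mA; apply: integrableS integrableT_gauss. Qed.

(** The total Gaussian mass is [sqrt pi]. Passing to the complementary integral makes [y] an upper
    endpoint, where the fundamental theorem of calculus applies. *)
Let erfcE y : erfc y = 2 / Num.sqrt pi * (Num.sqrt pi - gauss_cdf y).
Proof.
rewrite /erfc; congr (_ * _).
have -> : Num.sqrt pi = \int[mu]_(t in [set` `]-oo, +oo[]) gauss_fun t :> R.
  by rewrite set_itvNyy /Rintegral integralT_gauss.
rewrite /gauss_cdf Rintegral_itvB //; last exact: integrable_gauss.
by rewrite Rintegral_itv_obnd_cbnd //; exact: integrable_gauss.
Qed.

Let is_derive_gauss_cdf y : is_derive y 1 gauss_cdf (gauss_fun y).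
Proof.
(* The fundamental theorem is applied on []-oo, y + 1]], which has [y] in its interior. *)
have yy1 : y < y + 1 by rewrite ltrDl.
have mI : measurable [set` `]-oo, (y + 1)%R] : interval R] by exact: measurable_itv.
have [|dF F'] :=
  continuous_FTC1 yy1 (integrable_gauss mI) _ (@continuous_gauss_fun R y).
  exact: ltNyr.
by apply: DeriveDef; [exact: dF|rewrite -derive1E F'].
Qed.

Lemma is_derive_erfc y :
  is_derive y 1 erfc (- (2 / Num.sqrt pi) * expR (- y ^+ 2)).
Proof.
rewrite (_ : erfc =
    fun y => 2 / Num.sqrt pi * (Num.sqrt pi - gauss_cdf y)); last first.
  by apply/funext => ?; exact: erfcE.
have dF := is_derive_gauss_cdf y.
apply: is_derive_eq.
rewrite /gauss_fun /GRing.scale /=; ring.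
Qed.

Lemma erfc0 : erfc (0 : R) = 1.
Proof.
rewrite /erfc /Rintegral integral0y_gauss /=; field.
by rewrite gt_eqF // sqrtr_gt0 pi_gt0.
Qed.

(** The Gaussian is even, so [erfc (- y) + erfc y] has zero derivative and keeps its value 2 at the
    origin. *)
Lemma erfcN y : erfc (- y) = 2 - erfc y.
Proof.
apply/eqP; rewrite eq_sym subr_eq; apply/eqP.
pose f y : R := erfc (- y) + erfc y.
transitivity (f 0); first by rewrite /f oppr0 erfc0.
apply: is_derive_0_is_cst => {}y; rewrite /f.
have dy := is_derive_erfc y; have dNy := is_derive_erfc (- y).
apply: is_derive_eq.
rewrite /GRing.scale /= sqrrN; ring.
Qed.

Lemma erfc_ge0 y : 0 <= erfc y.
Proof.
by rewrite mulr_ge0 ?divr_ge0 ?sqrtr_ge0 // Rintegral_ge0.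
Qed.

Lemma continuous_erfc : continuous (@erfc R).
Proof.
move=> y; apply/differentiable_continuous/derivable1_diffP.
by have [] := is_derive_erfc y.
Qed.

End erfc.

(** * The fundamental theorem of calculus with a singular left endpoint *)

(** The function [f] may blow up at [a]. The interval is exhausted by segments [[c n, b]] on which
    the usual theorem holds; the integrals converge by monotone convergence, and the values
    [F (c n)] by right continuity of [F] at [a]. *)
Lemma ge0_integral_improper_left (R : realType) (f F : R -> R) (a b : R) :
  a < b -> (forall t, a < t -> 0 <= f t) -> {in `]a, +oo[, continuous f} ->
  (forall t, a < t -> is_derive t 1 F (f t)) -> F t @[t --> a^'+] --> F a ->
  (\int[lebesgue_measure]_(t in `]a, b]) (f t)%:E = (F b - F a)%:E)%E.
Proof.
move=> ab f0 cf dF Fa.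
have mf : measurable_fun `]a, +oo[ (EFin \o f).
  apply/measurable_EFinP; apply: open_continuous_measurable_fun => //.
  by move=> t; rewrite inE; exact: cf.
(* The denominator starts at 2 so that already [c 0 < b]. *)
pose c n := a + (b - a) / n.+2%:R.
have ba : 0 < b - a by rewrite subr_gt0.
have ac n : a < c n by rewrite ltrDl divr_gt0.
have cb n : c n < b.
  by rewrite -ltrBrDl ltr_pdivrMr // ltr_pMr // ltr1n.
have cS n m : (n <= m)%N -> c m <= c n.
  move=> nm; rewrite lerD2l; apply: ler_wpM2l; first exact: ltW.
  by rewrite lef_pV2 ?posrE // ler_nat.
have ca : c n @[n --> \oo] --> a.
  rewrite -[X in _ --> X]addr0; apply: cvgD; first exact: cvg_cst.
  rewrite -(mulr0 (b - a)); apply: cvgMr.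
  have -> : (fun n : nat => n.+2%:R^-1 : R) = (fun n => harmonic n.+1) by [].
  by rewrite (cvg_shiftS (@harmonic R)); exact: cvg_harmonic.
have cn : (\int[lebesgue_measure]_(t in `[c n, b]) (f t)%:E)%E @[n --> \oo] -->
    (F b - F a)%:E.
  rewrite (_ : (fun n => _) = (fun n => (F b - F (c n))%:E)).
    apply: cvg_EFin; first exact: nearW.
    apply: cvgB; first exact: cvg_cst.
    move/cvg_at_rightP : Fa; apply; split => //.
  apply/funext => n; rewrite (@continuous_FTC2 _ f F) //.
  - apply: continuous_in_subspaceT => t; rewrite inE /= in_itv /= => /andP[ct _].
    by apply: cf; rewrite in_itv /= andbT (lt_le_trans (ac n)).
  - split.
    + move=> t; rewrite in_itv /= => /andP[ct _].
      by have [] := dF t (lt_trans (ac n) ct).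
    + apply: cvg_at_right_filter; have [+ _] := dF _ (ac n).
      by move=> /derivable1_diffP/differentiable_continuous.
    + apply: cvg_at_left_filter; have [+ _] := dF _ ab.
      by move=> /derivable1_diffP/differentiable_continuous.
  - move=> t; rewrite in_itv /= => /andP[ct _].
    by rewrite derive1E; have [_ ->] := dF t (lt_trans (ac n) ct).
have cvI := @ge0_nondecreasing_set_cvg_integral _ (measurableTypeR R) R
  (fun n => `[c n, b]%classic) (EFin \o f) lebesgue_measure.
rewrite (_ : `]a, b]%classic = \bigcup_n `[c n, b]%classic).
  apply: (cvg_unique _ (cvI _ _ _ _) cn) => //.
  - apply/nondecreasing_seqP => n; rewrite subsetEset; apply: subset_itvr.
    by rewrite bnd_simp cS.
  - move=> n; apply: measurable_funS mf => // t /=; rewrite !in_itv /= => /andP[ct _].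
    by rewrite andbT (lt_le_trans (ac n)).
  - move=> n t; rewrite /= in_itv /= => /andP[ct _]; rewrite lee_fin.
    by apply: f0; rewrite (lt_le_trans (ac n)).
apply/seteqP; split => t /=; rewrite in_itv /=.
  move=> /andP[t_gt_a tb].
  have [n _ /(_ n (leqnn n)) /= cnt] := cvgr_lt a ca t t_gt_a.
  by exists n => //=; rewrite in_itv /= tb ltW.
by move=> [n _]; rewrite /= in_itv /= => /andP[ct ->]; rewrite (lt_le_trans (ac n)).
Qed.

(** * Partial sums of the hyperbolic cosine *)

Lemma continuous_c_ (R : realType) M : continuous (@c_ R M).
Proof.
elim: M => [|M ih] v.
  rewrite (_ : c_ 0 = cst 0); first exact: cst_continuous.
  by apply/funext => ?; rewrite /c_ big_ord0.
rewrite (_ : c_ M.+1 = fun g : R => c_ M g + g ^+ (2 * M) / (2 * M)`!%:R).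
  apply: continuousD; first exact: ih.
  by apply: continuousM; [exact: exprn_continuous|exact: cst_continuous].
by apply/funext => ?; rewrite /c_ big_ord_recr.
Qed.

(** The odd powers cancel between [v] and [- v]. *)
Lemma c__exp_sum (F : numFieldType) (M : nat) (v : F) :
  c_ M v = (exp_sum (2 * M) v + exp_sum (2 * M) (- v)) / 2.
Proof.
elim: M => [|M ih]; first by rewrite /c_ /exp_sum !big_ord0 addr0 mul0r.
rewrite (_ : 2 * M.+1 = (2 * M).+2)%N; last lia.
rewrite /c_ /exp_sum !big_ord_recr /= -/(c_ M v) -!/(exp_sum _ _) ih.
have NvE : (- v) ^+ (2 * M) = v ^+ (2 * M) by rewrite exprM sqrrN -exprM.
rewrite !exprS NvE.
by field; rewrite !pnatr_eq0 -!lt0n !fact_gt0.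
Qed.

Lemma cvg_c_ (R : realType) (v : R) :
  c_ M v @[M --> \oo] --> (expR v + expR (- v)) / 2.
Proof.
under eq_fun do rewrite c__exp_sum.
have dbl : (2 * M)%N @[M --> \oo] --> \oo.
  apply/cvgnyPge => A; near=> M.
  have : (A <= M)%N by near: M; exact: nbhs_infty_ge.
  lia.
apply: cvgMl; apply: cvgD.
  exact: (cvg_comp (fun M => 2 * M)%N (exp_sum ^~ v) dbl (@cvg_exp_sumR R v)).
exact: (cvg_comp (fun M => 2 * M)%N (exp_sum ^~ (- v)) dbl (@cvg_exp_sumR R (- v))).
Unshelve. all: by end_near. Qed.

Lemma c__term_ge0 (R : realType) (M : nat) (v : R) :
  0 <= v ^+ (2 * M) / (2 * M)`!%:R.
Proof. by rewrite divr_ge0 // exprM exprn_ge0 // sqr_ge0. Qed.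

Lemma c__ge0 (R : realType) (M : nat) (v : R) : 0 <= c_ M v.
Proof. by apply: sumr_ge0 => m _; exact: c__term_ge0. Qed.

Lemma c__nondecreasing (R : realType) (v : R) :
  nondecreasing_seq (fun M => c_ M v).
Proof.
apply/nondecreasing_seqP => M; rewrite /c_ big_ord_recr lerDl.
exact: c__term_ge0.
Qed.

(** * The limit of [IS_term] *)

(** The pointwise limit of the integrand of [IS_term], where [c_] has become a hyperbolic cosine. *)
Definition IS_kernel (R : realType) (x t : R) : R :=
  expR (- t) / Num.sqrt t *
    ((expR (x * Num.sqrt (2 * t)) + expR (- (x * Num.sqrt (2 * t)))) / 2).

(** With [s = sqrt t] and [y = x / sqrt 2], the form [IS_kernel x t dt] becomes [exp (y ^ 2) (exp (-
    (s - y) ^ 2) + exp (- (s + y) ^ 2)) ds], which integrates to this combination of [erfc]. *)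
Definition IS_primitive (R : realType) (x t : R) : R :=
  - (Num.sqrt pi / 2 * expR (x ^+ 2 / 2)) *
   (erfc (Num.sqrt t - x / Num.sqrt 2) + erfc (Num.sqrt t + x / Num.sqrt 2)).

Lemma is_derive_IS_primitive (R : realType) (x t : R) : 0 < t ->
  is_derive t 1 (IS_primitive x) (IS_kernel x t).
Proof.
move=> t0; set y := x / Num.sqrt 2.
have ds := is_derive1_sqrt t0.
have dm := is_derive_erfc (Num.sqrt t - y).
have dp := is_derive_erfc (Num.sqrt t + y).
have d1 : is_derive t 1 (fun t => Num.sqrt t - y) (2 * Num.sqrt t)^-1.
  by apply: is_derive_eq; rewrite subr0.
have d2 : is_derive t 1 (fun t => Num.sqrt t + y) (2 * Num.sqrt t)^-1.
  by apply: is_derive_eq; rewrite addr0.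
have d3 := @is_derive1_comp R erfc (fun t => Num.sqrt t - y) t _ _ dm d1.
have d4 := @is_derive1_comp R erfc (fun t => Num.sqrt t + y) t _ _ dp d2.
have d5 := is_deriveZ (- (Num.sqrt pi / 2 * expR (x ^+ 2 / 2)))
  (is_deriveD d3 d4).
apply: (is_derive_eq d5).
have s0 : Num.sqrt t != 0 by rewrite gt_eqF // sqrtr_gt0.
have p0 : Num.sqrt pi != 0 :> R by rewrite gt_eqF // sqrtr_gt0 pi_gt0.
have s20 : Num.sqrt 2 != 0 :> R by rewrite gt_eqF // sqrtr_gt0.
have ts : t = Num.sqrt t ^+ 2 by rewrite sqr_sqrtr // ltW.
have s22 : Num.sqrt 2 ^+ 2 = 2 :> R by rewrite sqr_sqrtr.
have xy : x = Num.sqrt 2 * y by rewrite /y mulrC divfK.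
(* Completing the square: [(sqrt t - y) ^ 2 = t - x sqrt (2 t) + x ^ 2 / 2], and likewise with the
   opposite sign of [y] in [E2]. *)
have E1 : expR (- (Num.sqrt t - y) ^+ 2) * expR (x ^+ 2 / 2) =
    expR (- t) * expR (x * Num.sqrt (2 * t)).
  rewrite -!expRD sqrtrM // xy exprMn s22 {2}ts; congr expR.
  rewrite -[Num.sqrt 2 * y * _](_ : Num.sqrt 2 ^+ 2 * y * Num.sqrt t = _);
    last by ring.
  by rewrite s22; field.
have E2 : expR (- (Num.sqrt t + y) ^+ 2) * expR (x ^+ 2 / 2) =
    expR (- t) * expR (- (x * Num.sqrt (2 * t))).
  rewrite -!expRD sqrtrM // xy exprMn s22 {2}ts; congr expR.
  rewrite -[Num.sqrt 2 * y * _](_ : Num.sqrt 2 ^+ 2 * y * Num.sqrt t = _);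
    last by ring.
  by rewrite s22; field.
rewrite /IS_kernel /GRing.scale /=.
transitivity ((expR (- (Num.sqrt t - y) ^+ 2) * expR (x ^+ 2 / 2) +
  expR (- (Num.sqrt t + y) ^+ 2) * expR (x ^+ 2 / 2)) / (2 * Num.sqrt t)).
  by field; rewrite s0 p0.
by rewrite E1 E2; field.
Qed.

(** Serves at [t = 0], where [sqrt] is continuous but not differentiable. *)
Lemma continuous_IS_primitive (R : realType) (x : R) : continuous (IS_primitive x).
Proof.
move=> t; rewrite /continuous_at /IS_primitive; apply: cvgMr.
apply: cvgD; apply: continuous_cvg; try exact: continuous_erfc.
  by apply: cvgB; [exact: sqrt_continuous|exact: cvg_cst].
by apply: cvgD; [exact: sqrt_continuous|exact: cvg_cst].
Qed.

Lemma cvg_IS_term (R : realType) (x x' : R) :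
  IS_term M x x' @[M --> \oo] -->
    4^-1 * (2 - erfc ((x' - x) / Num.sqrt 2) - erfc ((x' + x) / Num.sqrt 2)).
Proof.
have p0 : Num.sqrt pi != 0 :> R by rewrite gt_eqF // sqrtr_gt0 pi_gt0.
(* At [x' = 0] the sign kills [IS_term], and the claimed limit vanishes by [erfcN]. *)
have [->|x'0] := eqVneq x' 0.
  under eq_fun do rewrite /IS_term sgr0 mulr0 mul0r.
  rewrite sub0r add0r mulNr erfcN (_ : _ * _ = 0); first exact: cvg_cst.
  by ring.
set b := x' ^+ 2 / 2; have b0 : 0 < b by rewrite divr_gt0 // exprn_even_gt0.
pose h M (t : R) := expR (- t) / Num.sqrt t * c_ M (x * Num.sqrt (2 * t)).
have w0 (t : R) : 0 <= expR (- t) / Num.sqrt t.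
  by rewrite divr_ge0 ?expR_ge0 ?sqrtr_ge0.
have cs2 (t : R) : Num.sqrt (2 * u) @[u --> t] --> Num.sqrt (2 * t).
  apply: continuous_cvg; first exact: sqrt_continuous.
  by apply: cvgMr; exact: cvg_id.
have cw (t : R) : 0 < t ->
    expR (- u) / Num.sqrt u @[u --> t] --> expR (- t) / Num.sqrt t.
  move=> t0; apply: cvgM.
    apply: continuous_cvg; first exact: continuous_expR.
    by apply: cvgN; exact: cvg_id.
  by apply: cvgV; [rewrite gt_eqF // sqrtr_gt0|exact: sqrt_continuous].
(* The factor [1 / sqrt t] is continuous only away from 0, hence the half-open interval; the
   endpoint is a null set and is removed from the integral in [IE]. *)
have mh M : measurable_fun `]0, b]%classic (EFin \o h M).
  have mh0 : measurable_fun `](0 : R), +oo[%classic (EFin \o h M).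
    apply/measurable_EFinP; apply: open_continuous_measurable_fun => // t.
    rewrite inE /= in_itv /= andbT => t0; apply: cvgM; first exact: cw.
    apply: continuous_cvg; first exact: continuous_c_.
    by apply: cvgMr; exact: cs2.
  apply: measurable_funS mh0 => // t.
  by rewrite /= !in_itv /= andbT => /andP[].
have intE : (\int[lebesgue_measure]_(t in `]0%R, b]) (IS_kernel x t)%:E =
    (IS_primitive x b - IS_primitive x 0)%:E)%E.
  apply: (@ge0_integral_improper_left R (IS_kernel x) (IS_primitive x) 0 b b0
    _ _ (@is_derive_IS_primitive R x)).
  - move=> t _; rewrite mulr_ge0 // divr_ge0 // addr_ge0 ?expR_ge0.
  - move=> t; rewrite in_itv /= andbT => t0; apply: cvgM; first exact: cw.
    apply: cvgMl; apply: cvgD; apply: continuous_cvg; try exact: continuous_expR.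
      by apply: cvgMr; exact: cs2.
    by apply: cvgN; apply: cvgMr; exact: cs2.
  - by apply: cvg_at_right_filter; exact: continuous_IS_primitive.
have mono : (\int[lebesgue_measure]_(t in `]0%R, b]) (h M t)%:E)%E
    @[M --> \oo] -->
    (IS_primitive x b - IS_primitive x 0)%:E.
  rewrite -intE.
  have lim_h (t : R) : limn (fun M => (h M t)%:E) = (IS_kernel x t)%:E.
    apply/cvg_lim => //; apply: cvg_EFin; first exact: nearW.
    by apply: cvgMr; exact: cvg_c_.
  under eq_integral do rewrite -lim_h.
  apply: cvg_monotone_convergence => //.
  - by move=> M t _; rewrite lee_fin mulr_ge0 ?c__ge0.
  - by move=> t _ m n mn; rewrite lee_fin ler_wpM2l // c__nondecreasing.
have IE M : IS_term M x x' =
    expR (- (x ^+ 2 / 2)) / (2 * Num.sqrt pi) * Num.sg x' *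
    fine (\int[lebesgue_measure]_(t in `]0%R, b]) (h M t)%:E)%E.
  by rewrite /IS_term /Rintegral integral_itv_obnd_cbnd; last exact: mh.
under eq_fun do rewrite IE.
have -> : 4^-1 *
    (2 - erfc ((x' - x) / Num.sqrt 2) - erfc ((x' + x) / Num.sqrt 2)) =
    expR (- (x ^+ 2 / 2)) / (2 * Num.sqrt pi) * Num.sg x' *
    (IS_primitive x b - IS_primitive x 0).
  have sb : Num.sqrt b = `|x'| / Num.sqrt 2.
    by rewrite sqrtrM ?sqr_ge0 // sqrtr_sqr sqrtrV.
  (* At the endpoint 0 the two values of [erfc] add up to 2. *)
  rewrite /IS_primitive sqrtr0 sb sub0r add0r erfcN expRN.
  have e0 := expR_gt0 (x ^+ 2 / 2).
  rewrite (mulrDl x' (- x)) (mulrDl x' x) mulNr.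
  set y := x / Num.sqrt 2.
  have [x'_gt0|x'_lt0|x'E] := ltgtP 0 x'; last by rewrite x'E eqxx in x'0.
    rewrite gtr0_sg // gtr0_norm //; field.
    by rewrite p0 gt_eqF.
  (* For negative [x'] the reflection formula exchanges the two [erfc] terms, and the resulting sign
     is absorbed by that of [x']. *)
  have -> : `|x'| / Num.sqrt 2 - y = - (x' / Num.sqrt 2 + y).
    by rewrite ltr0_norm //; ring.
  have -> : `|x'| / Num.sqrt 2 + y = - (x' / Num.sqrt 2 - y).
    by rewrite ltr0_norm //; ring.
  rewrite ltr0_sg // !erfcN; field.
  by rewrite p0 gt_eqF.
by apply: cvgMr; apply: fine_cvg mono.
Qed.

(** * Limits of the entries of the kernel *)

(** By [erfcN] the function [erfc d - 1] is odd, so it equals [sg d * (erfc |d| - 1)]. *)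
Lemma erfc_sg (R : realType) (d : R) :
  2^-1 * (erfc d - 1 + Num.sg d) = 2^-1 * Num.sg d * erfc `|d|.
Proof.
have [d0|d0|<-] := ltgtP 0 d.
- by rewrite gtr0_sg // gtr0_norm //; ring.
- by rewrite ltr0_sg // ltr0_norm // erfcN; ring.
- by rewrite sgr0 normr0 erfc0; ring.
Qed.

Section kernel_limits.
Context {R : realType}.
Implicit Types (x : R) (z : R[i]).

Lemma scale_mx22 (K : nzRingType) (k a b c d : K) :
  k *: mx22 a b c d = mx22 (k * a) (k * b) (k * c) (k * d).
Proof. by apply/matrixP => i j; rewrite !mxE; case: ifP; case: ifP. Qed.

Lemma cexp_gauss_real x x' :
  cexp (- 2^-1 * (x%:C - x'%:C) ^+ 2) = (expR (- 2^-1 * (x - x') ^+ 2))%:C.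
Proof.
rewrite -cexp_real; congr cexp.
by rewrite rmorphM rmorphN fmorphV rmorph_nat rmorphXn rmorphB.
Qed.

Lemma sqrt2pi_E z :
  ((Num.sqrt (2 * pi))^-1
     * Num.sqrt (erfc (Num.sqrt 2 * complex.Im z)))%:C = sqrt2pi^-1 * E_ z.
Proof. by rewrite rmorphM fmorphV. Qed.

Lemma sqrt2pi_EE z z' :
  ((Num.sqrt (2 * pi))^-1
     * Num.sqrt (erfc (Num.sqrt 2 * complex.Im z)
                   * erfc (Num.sqrt 2 * complex.Im z')))%:C = sqrt2pi^-1 * E_ z * E_ z'.
Proof. by rewrite (sqrtrM _ (erfc_ge0 _)) !rmorphM fmorphV /= mulrA. Qed.

Lemma cvg_DS_real_real x x' :
  DS_ M (Rpt x) (Rpt x') @[M --> \oo] -->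
  (((Num.sqrt (2 * pi))^-1 * (x' - x) * expR (- 2^-1 * (x - x') ^+ 2))%:C : R[i]^o).
Proof.
apply: cvg_complex_eq; first exact: cvg_e_cexpN.
rewrite cexp_gauss_real !rmorphM fmorphV rmorphB /= /sqrt2pi.
by rewrite [_ / _]mulrC mulrAC.
Qed.

Lemma cvg_S_real_real x x' :
  S_ M (Rpt x) (Rpt x') @[M --> \oo] -->
    (((Num.sqrt (2 * pi))^-1 * expR (- 2^-1 * (x - x') ^+ 2))%:C : R[i]^o).
Proof.
apply: cvg_complex_eq.
  by apply: cvg_complexD; [exact: cvg_e_cexpN|apply: cvg_complexMl; exact: cvg_r_].
by rewrite mulr0 addr0 cexp_gauss_real rmorphM fmorphV mulrC.
Qed.

Lemma cvg_IS_real_real x x' :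
  IS_ M (Rpt x) (Rpt x') + curlyE (Rpt x) (Rpt x') @[M --> \oo] -->
    ((2^-1 * Num.sg (x - x') * erfc (`|x - x'| / Num.sqrt 2))%:C : R[i]^o).
Proof.
have s20 : 0 < Num.sqrt 2 :> R by rewrite sqrtr_gt0.
pose d := (x - x') / Num.sqrt 2.
have -> : 2^-1 * Num.sg (x - x') * erfc (`|x - x'| / Num.sqrt 2) =
    2^-1 * (erfc d - 1 + Num.sg d).
  rewrite erfc_sg /d sgrM normrM [Num.sg _^-1]gtr0_sg ?invr_gt0 // mulr1.
  by rewrite [`|_^-1|]gtr0_norm ?invr_gt0.
have sgd : Num.sg (x - x') = Num.sg d.
  by rewrite /d sgrM [Num.sg _^-1]gtr0_sg ?invr_gt0 // mulr1.
rewrite /IS_ /curlyE sgd; under eq_fun do rewrite -rmorphD.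
apply: cvg_realC.
(* The terms in [x + x'] cancel, and [(erfc d - erfc (- d)) / 4] is [(erfc d - 1) / 2]. *)
have -> : 2^-1 * (erfc d - 1 + Num.sg d) =
    4^-1 * (2 - erfc ((x' - x) / Num.sqrt 2) - erfc ((x' + x) / Num.sqrt 2)) -
    4^-1 * (2 - erfc ((x - x') / Num.sqrt 2) - erfc ((x + x') / Num.sqrt 2)) +
    2^-1 * Num.sg d.
  have -> : (x' - x) / Num.sqrt 2 = - d by rewrite /d -mulNr opprB.
  by rewrite erfcN [x' + x]addrC -/d; field.
by apply: cvgD; [apply: cvgB; exact: cvg_IS_term|exact: cvg_cst].
Qed.

Lemma cvg_DS_complex_complex z z' :
  DS_ M (Cpt z) (Cpt z') @[M --> \oo] -->
  (sqrt2pi^-1 * E_ z * E_ z' * ((z' - z) * cexp (- 2^-1 * (z - z') ^+ 2)) : R[i]^o).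
Proof.
apply: cvg_complex_eq; first exact: cvg_e_cexpN.
by move: (cexp _) (E_ z) (E_ z') => ? ? ?; ring.
Qed.

Lemma cvg_S_complex_complex z z' :
  S_ M (Cpt z) (Cpt z') @[M --> \oo] -->
  (sqrt2pi^-1 * E_ z * E_ z' *
     ('i%C * (conjc z' - z) * cexp (- 2^-1 * (z - conjc z') ^+ 2)) : R[i]^o).
Proof.
apply: cvg_complex_eq; first exact: cvg_e_cexpN.
by move: (cexp _) (E_ z) (E_ z') => ? ? ?; ring.
Qed.

Lemma cvg_IS_complex_complex z z' :
  IS_ M (Cpt z) (Cpt z') @[M --> \oo] -->
  (sqrt2pi^-1 * E_ z * E_ z' *
     (- (conjc z' - conjc z) * cexp (- 2^-1 * (conjc z - conjc z') ^+ 2)) : R[i]^o).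
Proof.
apply: cvg_complex_eq; first by apply: cvg_complexN; exact: cvg_e_cexpN.
by move: (cexp _) (E_ z) (E_ z') => ? ? ?; ring.
Qed.

Lemma cvg_DS_real_complex x z :
  DS_ M (Rpt x) (Cpt z) @[M --> \oo] -->
  (sqrt2pi^-1 * E_ z * ((z - x%:C) * cexp (- 2^-1 * (x%:C - z) ^+ 2)) : R[i]^o).
Proof.
apply: cvg_complex_eq; first exact: cvg_e_cexpN.
by move: (cexp _) (E_ z) => ? ?; ring.
Qed.

Lemma cvg_S_real_complex x z :
  S_ M (Rpt x) (Cpt z) @[M --> \oo] -->
  (sqrt2pi^-1 * E_ z *
     ('i%C * (conjc z - x%:C) * cexp (- 2^-1 * (x%:C - conjc z) ^+ 2)) : R[i]^o).
Proof.
apply: cvg_complex_eq; first exact: cvg_e_cexpN.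
by move: (cexp _) (E_ z) => ? ?; ring.
Qed.

Lemma cvg_S_complex_real z x :
  S_ M (Cpt z) (Rpt x) @[M --> \oo] -->
  (sqrt2pi^-1 * E_ z * cexp (- 2^-1 * (x%:C - z) ^+ 2) : R[i]^o).
Proof.
apply: cvg_complex_eq.
  by apply: cvg_complexD; [exact: cvg_e_cexpN|apply: cvg_complexMl; exact: cvg_r_].
by rewrite mulr0 addr0; move: (cexp _) (E_ z) => ? ?; ring.
Qed.

Lemma cvg_IS_real_complex x z :
  IS_ M (Rpt x) (Cpt z) @[M --> \oo] -->
  (sqrt2pi^-1 * E_ z * (- 'i%C * cexp (- 2^-1 * (x%:C - conjc z) ^+ 2)) : R[i]^o).
Proof.
apply: cvg_complex_eq.
  apply: cvg_complexMl; apply: cvg_complexD; first exact: cvg_e_cexpN.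
  by apply: cvg_complexMl; exact: cvg_r_.
by rewrite mulr0 addr0; move: (cexp _) (E_ z) => ? ?; ring.
Qed.

Lemma cvg_ginibreK (g g' : Defs.point R) (a b c d : R[i]) :
  DS_ M g g' @[M --> \oo] --> (a : R[i]^o) ->
  S_ M g g' @[M --> \oo] --> (b : R[i]^o) ->
  S_ M g' g @[M --> \oo] --> (c : R[i]^o) ->
  IS_ M g g' + curlyE g g' @[M --> \oo] --> (d : R[i]^o) ->
  ginibreK M g g' @[M --> \oo] --> (mx22 a b (- c) d : 'M[R[i]^o]_2).
Proof.
move=> DSa Sb Sc ISd; apply: (@cvg_mx22 R[i]^o _ _ _ _ _ _ _ _ DSa Sb _ ISd).
exact: cvg_complexN.
Qed.

End kernel_limits.

(** * Assembly of the matrix limits in the three cases *)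

Unset Implicit Arguments.

Theorem corollary7p2 (R : realType) (x x' : R) (z z' : R[i])
    (hz : 0 < complex.Im z) (hz' : 0 < complex.Im z') :
  [/\ ginibreK M (Rpt x) (Rpt x') @[M --> \oo] -->
        (mx22
          ((Num.sqrt (2 * pi))^-1 * (x' - x) * expR (- 2^-1 * (x - x') ^+ 2))%:C
          ((Num.sqrt (2 * pi))^-1 * expR (- 2^-1 * (x - x') ^+ 2))%:C
          (- ((Num.sqrt (2 * pi))^-1 * expR (- 2^-1 * (x - x') ^+ 2)))%:C
          (2^-1 * Num.sg (x - x') * erfc (`|x - x'| / Num.sqrt 2))%:C
         : 'M[R[i]^o]_2),
      ginibreK M (Cpt z) (Cpt z') @[M --> \oo] -->
        (((Num.sqrt (2 * pi))^-1
            * Num.sqrt (erfc (Num.sqrt 2 * complex.Im z)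
                          * erfc (Num.sqrt 2 * complex.Im z')))%:C
         *: mx22
          ((z' - z) * cexp (- 2^-1 * (z - z') ^+ 2))
          ('i%C * (conjc z' - z) * cexp (- 2^-1 * (z - conjc z') ^+ 2))
          ('i%C * (z' - conjc z) * cexp (- 2^-1 * (conjc z - z') ^+ 2))
          (- (conjc z' - conjc z) * cexp (- 2^-1 * (conjc z - conjc z') ^+ 2))
         : 'M[R[i]^o]_2)
    & ginibreK M (Rpt x) (Cpt z) @[M --> \oo] -->
        (((Num.sqrt (2 * pi))^-1
            * Num.sqrt (erfc (Num.sqrt 2 * complex.Im z)))%:C
         *: mx22
          ((z - x%:C) * cexp (- 2^-1 * (x%:C - z) ^+ 2))
          ('i%C * (conjc z - x%:C) * cexp (- 2^-1 * (x%:C - conjc z) ^+ 2))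
          (- cexp (- 2^-1 * (x%:C - z) ^+ 2))
          (- 'i%C * cexp (- 2^-1 * (x%:C - conjc z) ^+ 2))
         : 'M[R[i]^o]_2)].
Proof.
split.
- rewrite rmorphN; apply: cvg_ginibreK.
  + exact: cvg_DS_real_real.
  + exact: cvg_S_real_real.
  + rewrite -sqrrN opprB; exact: cvg_S_real_real.
  + exact: cvg_IS_real_real.
- rewrite scale_mx22 sqrt2pi_EE.
  (* The lower left entry is rewritten as minus the limit of [S_] with [z] and [z'] exchanged; the
     sign passes into the odd linear factor, while the square is even. *)
  have -> : sqrt2pi^-1 * E_ z * E_ z' *
        ('i%C * (z' - conjc z) * cexp (- 2^-1 * (conjc z - z') ^+ 2)) =
      - (sqrt2pi^-1 * E_ z' * E_ z *
        ('i%C * (conjc z - z') * cexp (- 2^-1 * (z' - conjc z) ^+ 2))).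
    rewrite -[(z' - _) ^+ 2]sqrrN opprB.
    by move: (cexp _) (E_ z) (E_ z') => ? ? ?; ring.
  apply: cvg_ginibreK.
  + exact: cvg_DS_complex_complex.
  + exact: cvg_S_complex_complex.
  + exact: cvg_S_complex_complex.
  (* [curlyE] vanishes unless both points are real. *)
  + under eq_fun do rewrite addr0.
    exact: cvg_IS_complex_complex.
- rewrite scale_mx22 sqrt2pi_E mulrN.
  apply: cvg_ginibreK.
  + exact: cvg_DS_real_complex.
  + exact: cvg_S_real_complex.
  + exact: cvg_S_complex_real.
  + under eq_fun do rewrite addr0.
    exact: cvg_IS_real_complex.
Qed.
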